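(* Let $\mathcal{G}$ be an undirected connected graph on $\mathcal{V}=\{1,\dots,n\}$ and let $d\ge 2$. For each $i\in\mathcal{V}$ let $\alpha_i>0$ and let $\mathbf{A}_i\in\mathbb{R}^{d\times d}$ be an invertible (not necessarily symmetric) matrix for which there is a constant $\gamma_i>0$ such that $\mathbf{y}^\top\mathbf{A}_i^{-1}\mathbf{y}\ge\gamma_i\|\mathbf{y}\|^2$ for every nonzero $\mathbf{y}\in\mathbb{R}^d$. Let $\gamma_{\min}=\min_i\gamma_i$, $\alpha_{\max}=\max_i\alpha_i$ and $L_V=\|\mathbf{L}^{\mathrm{o}}\|$. If $0<\alpha_{\max}<2\gamma_{\min}/L_V$, then for every $\mathbf{x}(0)\in\mathbb{R}^{dn}$ the sequence $\{\mathbf{x}(k)\}$ generated by $$\mathbf{x}_i(k+1)=\mathbf{x}_i(k)-\alpha_i\sum_{j\in\mathcal{N}_i}\mathbf{A}_i(\mathbf{x}_i(k)-\mathbf{x}_j(k)),\qquad i\in\mathcal{V},\ k=0,1,2,\dots,$$ is bounded and converges geometrically to a consensus point: $\lim_{k\to\infty}\mathbf{x}(k)=\mathbf{1}_n\otimes\mathbf{x}^*$ for some $\mathbf{x}^*\in\mathbb{R}^d$.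
   Context: $\mathcal{N}_i$ is the set of neighbors of $i$ in $\mathcal{G}$. $\mathbf{L}^{\mathrm{o}}\in\mathbb{R}^{dn\times dn}$ is the identity-matrix weighted Laplacian of $\mathcal{G}$: its $(i,i)$ block is $|\mathcal{N}_i|\mathbf{I}_d$, its $(i,j)$ block is $-\mathbf{I}_d$ if $j\in\mathcal{N}_i$, and $\mathbf{0}$ otherwise. $\|\cdot\|$ is the Euclidean norm on vectors and the induced (spectral) norm on matrices. $\mathbf{x}(k)=[\mathbf{x}_1^\top(k),\dots,\mathbf{x}_n^\top(k)]^\top\in\mathbb{R}^{dn}$ with $\mathbf{x}_i(k)\in\mathbb{R}^d$; $\mathbf{1}_n$ is the all-ones vector. With $\mathbf{G}=\mathrm{diag}(\alpha_1\mathbf{A}_1,\dots,\alpha_n\mathbf{A}_n)$ the iteration reads $\mathbf{x}(k+1)=\mathbf{x}(k)-\mathbf{G}\mathbf{L}^{\mathrm{o}}\mathbf{x}(k)$. Converging geometrically to a limit $\mathbf{z}$ means there exist $C\ge0$ and $q\in[0,1)$ with $\|\mathbf{x}(k)-\mathbf{z}\|\le Cq^k$ for all $k$. *)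

(* Defs.v *)
From HB Require Import structures.
From mathcomp Require Import all_boot all_order all_algebra.
From mathcomp Require Import all_classical all_reals all_analysis.

Set Implicit Arguments.
Unset Strict Implicit.
Unset Printing Implicit Defensive.

Import Order.TTheory GRing.Theory Num.Theory.
Import numFieldNormedType.Exports.

Local Open Scope classical_set_scope.
Local Open Scope ring_scope.

Definition neighbors (n : nat) (e : rel 'I_n) (i : 'I_n) : {set 'I_n} :=
  [set j | e i j]%SET.

Definition connected_graph (n : nat) (e : rel 'I_n) : Prop :=
  forall i j : 'I_n, connect e i j.

(* The norm that the library puts on matrices is the sup norm of the entries,
   hence the explicit Euclidean and spectral norms. *)
Definition norm2 (R : realType) (m : nat) (v : 'cV[R]_m) : R :=
  Num.sqrt (\sum_(i < m) v i 0 ^+ 2).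

Definition spectral_norm (R : realType) (m p : nat) (M : 'M[R]_(m, p)) : R :=
  sup [set norm2 (M *m v) | v in [set v : 'cV[R]_p | norm2 v <= 1]].

(* R^(dn) is represented as 'cV_(\sum_(i < n) d), the type of columns made of
   n blocks of height d. *)
Definition stack (R : realType) (n d : nat) (x : 'I_n -> 'cV[R]_d) :
    'cV[R]_(\sum_(i < n) d) :=
  \mxcol_(i < n) x i.

(* The Kronecker product of the all-ones vector with xs. *)
Definition consensus (R : realType) (n d : nat) (xs : 'cV[R]_d) :
    'cV[R]_(\sum_(i < n) d) :=
  stack (fun _ : 'I_n => xs).

Definition laplacian (R : realType) (n d : nat) (e : rel 'I_n) :
    'M[R]_(\sum_(i < n) d, \sum_(j < n) d) :=
  \mxblock_(i < n, j < n)
    (if i == j then (#|neighbors e i|%:R)%:M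
     else if j \in neighbors e i then - 1%:M
     else 0 : 'M[R]_d).

(* The seed of the iterated min/max is itself a member of the family. *)
Definition family_min (R : realType) (n : nat) (f : 'I_n.+1 -> R) : R :=
  \big[Num.min/f ord0]_(i < n.+1) f i.

Definition family_max (R : realType) (n : nat) (f : 'I_n.+1 -> R) : R :=
  \big[Num.max/f ord0]_(i < n.+1) f i.

Definition bounded_seq (R : realType) (m : nat) (u : nat -> 'cV[R]_m) : Prop :=
  exists M : R, forall k : nat, norm2 (u k) <= M.

Definition converges_geometrically (R : realType) (m : nat)
    (u : nat -> 'cV[R]_m) (z : 'cV[R]_m) : Prop :=
  exists C q : R,
    [/\ 0 <= C, 0 <= q < 1 & forall k : nat, norm2 (u k - z) <= C * q ^+ k].

(* Main.v *)
Require Import Defs.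
From HB Require Import structures.
From mathcomp Require Import all_boot all_order all_algebra.
From mathcomp Require Import all_classical all_reals all_analysis.
From mathcomp Require Import ring lra.

Set Implicit Arguments.
Unset Strict Implicit.
Unset Printing Implicit Defensive.

Import Order.TTheory GRing.Theory Num.Theory.
Import numFieldNormedType.Exports.

Local Open Scope classical_set_scope.
Local Open Scope ring_scope.

(** Why the iteration converges.  Write L for the Laplacian, X for the stacked
    state and W for the displacement of one step, so that the next state is
    X - W and the i-th block of W is alpha_i A_i y_i, where y = L X.  The
    Lyapunov function is the Dirichlet energy V(X) = X^T L X, which is half the
    sum of |x_i - x_j|^2 over all oriented edges.  It satisfies
      V(X - W) = V(X) - 2 W^T (L X) + W^T L W.
    Positivity of A_i^{-1}, applied to A_i y_i, bounds W^T (L X) below by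
    (gamma_min / alpha_max) |W|^2 ([gain_dissipation]), and the spectral norm
    bounds W^T L W above by L_V |W|^2 ([energyB_le]).  The step-size condition
    says precisely that the first effect wins, so the energy drops by at least
    a positive multiple of |W|^2.

    For the drop to be proportional to the energy itself one needs
    V(X) <= const |L X|^2 <= const' |W|^2.  The second inequality holds because
    every A_i is invertible ([gain_injective]).  The first one follows, without
    diagonalising L, from connectedness: along a path, |x_i - x_j| is at most
    n sqrt(V) ([disagreement_le_energy]), so that X is within a multiple of
    sqrt(V) of a consensus vector, and consensus vectors are in the kernel of
    L; Cauchy-Schwarz concludes ([energy_le_laplacian_sq]).

    Hence V decays geometrically ([energy_contraction]), and so do the
    displacements |W| and all the disagreements |x_i - x_j|.  The first block
    then has geometrically decaying increments and converges
    ([geometric_limit_cV]), and the other blocks follow it. *)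

(** * Euclidean inner product and norms *)

Definition dot (R : realType) (m : nat) (u v : 'cV[R]_m) : R :=
  (u^T *m v) 0 0.

Section EuclideanNorm.
Variables (R : realType) (m : nat).
Implicit Types (u v w : 'cV[R]_m) (a : R).

Lemma dotE u v : dot u v = \sum_(i < m) u i 0 * v i 0.
Proof. by rewrite /dot mxE; apply: eq_bigr => i _; rewrite mxE. Qed.

Lemma dotC u v : dot u v = dot v u.
Proof. by rewrite !dotE; apply: eq_bigr => i _; rewrite mulrC. Qed.

Lemma dotDr u v w : dot u (v + w) = dot u v + dot u w.
Proof. by rewrite /dot mulmxDr mxE. Qed.

Lemma dotZr a u v : dot u (a *: v) = a * dot u v.
Proof. by rewrite /dot -scalemxAr mxE. Qed.

Lemma dotBr u v w : dot u (v - w) = dot u v - dot u w.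
Proof. by rewrite -scaleN1r dotDr dotZr mulN1r. Qed.

Lemma dotZl a u v : dot (a *: u) v = a * dot u v.
Proof. by rewrite dotC dotZr dotC. Qed.

Lemma dotBl u v w : dot (u - v) w = dot u w - dot v w.
Proof. by rewrite !(dotC _ w) dotBr. Qed.

Lemma dotDl u v w : dot (u + v) w = dot u w + dot v w.
Proof. by rewrite !(dotC _ w) dotDr. Qed.

Lemma dot_ge0 u : 0 <= dot u u.
Proof. by rewrite dotE sumr_ge0 // => i _; rewrite -expr2 sqr_ge0. Qed.

Lemma norm2_ge0 u : 0 <= norm2 u.
Proof. exact: sqrtr_ge0. Qed.

Lemma norm2_sq u : norm2 u ^+ 2 = dot u u.
Proof.
rewrite sqr_sqrtr ?sumr_ge0 // => [|i _]; last exact: sqr_ge0.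
by rewrite dotE; apply: eq_bigr => i _; rewrite expr2.
Qed.

Lemma norm2Z a u : norm2 (a *: u) = `|a| * norm2 u.
Proof.
apply/eqP; rewrite -(@eqrXn2 _ 2) ?mulr_ge0 ?norm2_ge0 //.
by rewrite exprMn !norm2_sq dotZl dotZr mulrA real_normK ?num_real.
Qed.

Lemma norm2_0 : norm2 (0 : 'cV[R]_m) = 0.
Proof. by rewrite -(scale0r 0) norm2Z normr0 mul0r. Qed.

Lemma norm2N u : norm2 (- u) = norm2 u.
Proof. by rewrite -scaleN1r norm2Z normrN1 mul1r. Qed.

Lemma norm2_eq0 u : norm2 u = 0 -> u = 0.
Proof.
move=> u0; have /eqP : \sum_(i < m) u i 0 * u i 0 = 0.
  by rewrite -dotE -norm2_sq u0 expr0n.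
rewrite psumr_eq0 => [/allP h|i _]; last by rewrite -expr2 sqr_ge0.
apply/matrixP => i j; rewrite ord1 mxE; apply/eqP.
by have := h i (mem_index_enum _); rewrite /= mulf_eq0 orbb.
Qed.

Lemma cauchy_schwarz u v : dot u v <= norm2 u * norm2 v.
Proof.
have [v0|vN0] := eqVneq (norm2 v) 0.
  by rewrite v0 mulr0 (norm2_eq0 v0) /dot mulmx0 mxE.
have v_gt0 : 0 < norm2 v by rewrite lt_neqAle eq_sym vN0 norm2_ge0.
have v2_gt0 : 0 < dot v v by rewrite -norm2_sq exprn_gt0.
apply: (le_trans (ler_norm _)).
rewrite -(@ler_pXn2r _ 2) ?nnegrE ?mulr_ge0 ?norm2_ge0 //.
rewrite exprMn !norm2_sq real_normK ?num_real //.
(* |v|^2 times the deficit is the square norm of |v|^2 u - (u.v) v. *)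
rewrite -subr_ge0 -(pmulr_rge0 _ v2_gt0).
have := dot_ge0 (dot v v *: u - dot u v *: v).
rewrite !(dotBl, dotBr, dotZl, dotZr) (dotC v u).
by congr (0 <= _); ring.
Qed.

Lemma ler_norm2D u v : norm2 (u + v) <= norm2 u + norm2 v.
Proof.
rewrite -(@ler_pXn2r _ 2) ?nnegrE ?addr_ge0 ?norm2_ge0 //.
rewrite sqrrD !norm2_sq dotDl !dotDr (dotC v u).
by have := cauchy_schwarz u v; lra.
Qed.

Lemma ler_coord_norm2 u i : `|u i 0| <= norm2 u.
Proof.
rewrite -(@ler_pXn2r _ 2) ?nnegrE ?norm2_ge0 //.
rewrite real_normK ?num_real // norm2_sq dotE (bigD1 i) //= expr2 lerDl.
by rewrite sumr_ge0 // => j _; rewrite -expr2 sqr_ge0.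
Qed.

Lemma norm2_le_sum u : norm2 u <= \sum_(i < m) `|u i 0|.
Proof.
rewrite -(@ler_pXn2r _ 2) ?nnegrE ?norm2_ge0 ?sumr_ge0 //.
rewrite norm2_sq dotE expr2 mulr_suml ler_sum // => i _.
apply: (le_trans (ler_norm _)); rewrite normrM ler_wpM2l //.
by rewrite (bigD1 i) //= lerDl sumr_ge0.
Qed.

Lemma mx_norm_le_norm2 u : `|u| <= norm2 u.
Proof.
rewrite /Num.Def.normr /= mx_normrE; apply: bigmax_le => [|[i j] _ /=].
  exact: norm2_ge0.
by rewrite ord1 ler_coord_norm2.
Qed.

End EuclideanNorm.

(** Some operator bound exists: this makes the supremum that defines the
    spectral norm that of a bounded set. *)
Lemma norm2_mulmx_le (R : realType) (m p : nat) (M : 'M[R]_(m, p)) :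
  exists2 C, 0 <= C & forall v, norm2 (M *m v) <= C * norm2 v.
Proof.
exists (\sum_i \sum_j `|M i j|).
  by rewrite sumr_ge0 // => i _; rewrite sumr_ge0.
move=> v; apply: (le_trans (norm2_le_sum _)).
rewrite mulr_suml ler_sum // => i _; rewrite mxE mulr_suml.
apply: (le_trans (ler_norm_sum _ _ _)); rewrite ler_sum // => j _.
by rewrite normrM ler_wpM2l // ler_coord_norm2.
Qed.

Lemma norm2_mulmx (R : realType) (m p : nat) (M : 'M[R]_(m, p)) v :
  norm2 (M *m v) <= spectral_norm M * norm2 v.
Proof.
have [C C0 MC] := norm2_mulmx_le M.
have [v0|vN0] := eqVneq (norm2 v) 0.
  by rewrite v0 mulr0 -(mulr0 C) -v0 MC.
have v_gt0 : 0 < norm2 v by rewrite lt_neqAle eq_sym vN0 norm2_ge0.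
rewrite -ler_pdivrMr //; apply: ub_le_sup.
  exists C => _ /= [w w1 <-]; apply: (le_trans (MC w)).
  by rewrite ler_piMr.
exists ((norm2 v)^-1 *: v) => /=.
  by rewrite norm2Z ger0_norm ?invr_ge0 ?norm2_ge0 // mulVf.
by rewrite -scalemxAr norm2Z ger0_norm ?invr_ge0 ?norm2_ge0 // mulrC.
Qed.

Lemma spectral_norm_ge0 (R : realType) (m p : nat) (M : 'M[R]_(m, p)) :
  0 <= spectral_norm M.
Proof.
have [C C0 MC] := norm2_mulmx_le M.
apply: ub_le_sup.
  exists C => _ /= [w w1 <-]; apply: (le_trans (MC w)).
  by rewrite ler_piMr.
by exists 0; rewrite ?mulmx0 /= norm2_0.
Qed.

(** * Stacked vectors *)

Section Stack.
Variables (R : realType) (n d : nat).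
Implicit Types (x y : 'I_n -> 'cV[R]_d).

Lemma dot_stack x y : dot (stack x) (stack y) = \sum_i dot (x i) (y i).
Proof. by rewrite /dot /stack tr_mxcol mul_mxrow_mxcol summxE. Qed.

Lemma stackB x y : stack x - stack y = stack (fun i => x i - y i).
Proof. by rewrite /stack mxcolB. Qed.

Lemma norm2_stack_sq x : norm2 (stack x) ^+ 2 = \sum_i norm2 (x i) ^+ 2.
Proof.
by rewrite norm2_sq dot_stack; apply: eq_bigr => i _; rewrite norm2_sq.
Qed.

Lemma norm2_stack_le x : norm2 (stack x) <= \sum_i norm2 (x i).
Proof.
have S0 : 0 <= \sum_i norm2 (x i).
  by rewrite sumr_ge0 // => i _; exact: norm2_ge0.
rewrite -(@ler_pXn2r _ 2) ?nnegrE ?norm2_ge0 //.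
rewrite norm2_stack_sq [in leRHS]expr2 mulr_suml ler_sum // => i _.
rewrite expr2 ler_wpM2l ?norm2_ge0 // (bigD1 i) //= lerDl.
by rewrite sumr_ge0 // => j _; exact: norm2_ge0.
Qed.

Lemma norm2_block_le x i : norm2 (x i) <= norm2 (stack x).
Proof.
rewrite -(@ler_pXn2r _ 2) ?nnegrE ?norm2_ge0 //.
rewrite norm2_stack_sq (bigD1 i) //= lerDl.
by rewrite sumr_ge0 // => j _; exact: sqr_ge0.
Qed.

End Stack.

(** * The Laplacian and its Dirichlet energy *)

Section DirichletEnergy.
Variables (R : realType) (n d : nat) (e : rel 'I_n).
Hypotheses (e_sym : symmetric e) (e_irr : irreflexive e).
Implicit Types (x : 'I_n -> 'cV[R]_d) (X Y W : 'cV[R]_(\sum_(i < n) d)).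

Local Notation L := (laplacian R d e).

Lemma laplacian_stack x :
  L *m stack x = stack (fun i => \sum_(j in neighbors e i) (x i - x j)).
Proof.
rewrite /laplacian /stack mul_mxblock_mxrow; apply: eq_mxcol => i.
rewrite (bigD1 i) //= eqxx big_split /= sumr_const mul_scalar_mx scaler_nat.
congr (_ + _).
rewrite [RHS]big_mkcond [RHS](bigD1 i) //= {2}/neighbors inE e_irr add0r.
apply: eq_bigr => j ji; rewrite eq_sym (negPf ji).
by case: ifP => _; rewrite ?mulNmx ?mul1mx ?mul0mx.
Qed.

Lemma laplacian_consensus (xs : 'cV[R]_d) : L *m consensus n xs = 0.
Proof.
rewrite laplacian_stack /stack -[RHS](mxcol0 (p_ := fun=> d)).
apply: eq_mxcol => i.
by rewrite big1 // => j _; rewrite subrr.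
Qed.

Lemma tr_laplacian : L^T = L.
Proof.
rewrite /laplacian tr_mxblock; apply: eq_mxblock => i j.
rewrite eq_sym !inE e_sym; case: eqP => [->|_]; first exact: tr_scalar_mx.
by case: ifP => _; rewrite ?linearN /= ?tr_scalar_mx ?trmx0.
Qed.

Lemma dot_laplacianC X Y : dot X (L *m Y) = dot Y (L *m X).
Proof. by rewrite (dotC Y) /dot trmx_mul tr_laplacian mulmxA. Qed.

Definition energy X : R := dot X (L *m X).

(** Each undirected edge is seen from both ends; adding the two expressions of
    the energy symmetrises x_i . (x_i - x_j) into |x_i - x_j|^2. *)
Lemma energy_stack x : energy (stack x) =
  (\sum_i \sum_(j in neighbors e i) norm2 (x i - x j) ^+ 2) / 2.
Proof.
have E1 : energy (stack x) =
    \sum_i \sum_(j in neighbors e i) dot (x i) (x i - x j).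
  rewrite /energy laplacian_stack dot_stack; apply: eq_bigr => i _.
  by rewrite /dot mulmx_sumr summxE.
have E2 : energy (stack x) =
    \sum_i \sum_(j in neighbors e i) dot (x j) (x j - x i).
  rewrite E1 (exchange_big_dep xpredT) //=.
  by apply: eq_bigr => i _; apply: eq_bigl => j; rewrite !inE e_sym.
suff -> : \sum_i \sum_(j in neighbors e i) norm2 (x i - x j) ^+ 2 =
    energy (stack x) + energy (stack x) by lra.
rewrite {1}E1 E2 -big_split /=; apply: eq_bigr => i _.
rewrite -big_split /=; apply: eq_bigr => j _.
by rewrite norm2_sq !(dotBl, dotBr); ring.
Qed.

Lemma energy_ge0 X : 0 <= energy X.
Proof.
rewrite -[X]submxcolK -/(stack (fun i => submxcol X i)) energy_stack.
rewrite divr_ge0 //.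
by rewrite sumr_ge0 // => i _; rewrite sumr_ge0 // => j _; exact: sqr_ge0.
Qed.

(** No factor 2 is lost: an edge contributes both orientations to the double
    sum, which makes up for the division by 2. *)
Lemma edge_le_energy x i j :
  e i j -> norm2 (x i - x j) <= Num.sqrt (energy (stack x)).
Proof.
move=> eij.
have ij : i != j by apply: contraTneq eij => ->; rewrite e_irr.
rewrite -(@ler_pXn2r _ 2) ?nnegrE ?norm2_ge0 ?sqrtr_ge0 //.
rewrite [Num.sqrt (energy _) ^+ 2]sqr_sqrtr ?energy_ge0 // energy_stack.
rewrite ler_pdivlMr //.
pose S k := \sum_(l in neighbors e k) norm2 (x k - x l) ^+ 2.
have S_ge k l : e k l -> norm2 (x k - x l) ^+ 2 <= S k.
  move=> kl; rewrite /S (bigD1 l) ?inE //= lerDl.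
  by rewrite sumr_ge0 // => h _; exact: sqr_ge0.
have S_ge0 k : 0 <= S k by rewrite sumr_ge0 // => h _; exact: sqr_ge0.
have Si := S_ge _ _ eij.
have Sj : norm2 (x i - x j) ^+ 2 <= S j.
  by rewrite -norm2N opprB S_ge // e_sym.
rewrite -[leRHS]/(\sum_k S k) (bigD1 i) //= (bigD1 j) 1?eq_sym //= addrA.
rewrite mulr_natr mulr2n -[leLHS]addr0 !lerD //.
by rewrite sumr_ge0 // => k _; exact: S_ge0.
Qed.

Lemma path_le_energy x i p : path e i p ->
  norm2 (x i - x (last i p)) <= (size p)%:R * Num.sqrt (energy (stack x)).
Proof.
elim: p i => [|j p IH] i /=; first by rewrite subrr mul0r norm2_0.
case/andP => eij /IH pj; rewrite -(subrKA (x j)).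
apply: (le_trans (ler_norm2D _ _)).
by rewrite -natr1 mulrDl mul1r addrC lerD // edge_le_energy.
Qed.

Hypothesis e_conn : connected_graph e.

Lemma disagreement_le_energy x i j :
  norm2 (x i - x j) <= n%:R * Num.sqrt (energy (stack x)).
Proof.
have /connectP[p ep ->] := e_conn i j.
(* A path without repeated vertices has fewer than n edges. *)
case/shortenP: ep => p' ep' up' _.
apply: (le_trans (path_le_energy x ep')).
rewrite ler_wpM2r ?sqrtr_ge0 // ler_nat.
have /card_uniqP sizep : uniq (i :: p') := up'.
have := max_card (mem (i :: p')); rewrite sizep card_ord; exact: ltnW.
Qed.

End DirichletEnergy.

(** A spectral gap in disguise.  Subtracting the consensus vector of the first
    block changes X to Y with X^T L X = Y^T L X <= |Y| |L X|, and
    |Y|^2 <= const V(X) because disagreements are controlled by the energy; it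
    remains to cancel one factor V(X) from V(X)^2 <= const V(X) |L X|^2. *)
Lemma energy_le_laplacian_sq (R : realType) (n d : nat) (e : rel 'I_n.+1)
    (e_sym : symmetric e) (e_irr : irreflexive e) (e_conn : connected_graph e)
    (x : 'I_n.+1 -> 'cV[R]_d) :
  energy e (stack x) <= n.+1%:R ^+ 3 * norm2 (laplacian R d e *m stack x) ^+ 2.
Proof.
set V := energy e (stack x); set N := n.+1%:R : R; set l := norm2 (_ *m _).
have V0 : 0 <= V by exact: energy_ge0.
have l0 : 0 <= l by exact: norm2_ge0.
have N0 : 0 <= N by exact: ler0n.
have [->|VN0] := eqVneq V 0; first by rewrite mulr_ge0 ?exprn_ge0.
have V_gt0 : 0 < V by rewrite lt_neqAle eq_sym VN0.
pose y i := x i - x ord0.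
have Vy : V <= norm2 (stack y) * l.
  suff -> : V = dot (stack y) (laplacian R d e *m stack x).
    exact: cauchy_schwarz.
  have -> : stack y = stack x - consensus n.+1 (x ord0) by rewrite stackB.
  rewrite dotBl [X in _ - X]dot_laplacianC // laplacian_consensus //.
  by rewrite [X in _ - X]/dot mulmx0 mxE subr0.
have yV : norm2 (stack y) ^+ 2 <= N ^+ 3 * V.
  rewrite norm2_stack_sq.
  have -> : N ^+ 3 * V = \sum_(i < n.+1) (N * Num.sqrt V) ^+ 2.
    by rewrite sumr_const card_ord exprMn sqr_sqrtr // -mulr_natl -/N; ring.
  apply: ler_sum => i _.
  rewrite ler_pXn2r ?nnegrE ?norm2_ge0 ?mulr_ge0 ?sqrtr_ge0 //.
  exact: disagreement_le_energy.
rewrite -(ler_pM2l V_gt0) -expr2.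
apply: (@le_trans _ _ ((norm2 (stack y) * l) ^+ 2)).
  by rewrite ler_pXn2r ?nnegrE // mulr_ge0 ?norm2_ge0.
by rewrite exprMn [leRHS]mulrCA mulrA ler_wpM2r // exprn_ge0.
Qed.

(** * Geometrically convergent sequences *)

(** With D = C / (1 - q), the sequences u_k - D q^k and u_k + D q^k are
    nondecreasing and nonincreasing; the supremum of the former lies between
    them at every k, which gives the limit together with its rate. *)
Lemma geometric_limit (R : realType) (u : nat -> R) (C q : R) :
    0 <= q < 1 -> (forall k, `|u k.+1 - u k| <= C * q ^+ k) ->
  exists l, forall k, `|u k - l| <= C / (1 - q) * q ^+ k.
Proof.
move=> /andP[q0 q1] uC; set D := C / (1 - q).
have C0 : 0 <= C by have := le_trans (normr_ge0 _) (uC 0%N); rewrite mulr1.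
have DC : D * (1 - q) = C by rewrite divfK // subr_eq0 eq_sym lt_eqF.
have D0 : 0 <= D by rewrite divr_ge0 // subr_ge0 ltW.
have step k : u k - D * q ^+ k <= u k.+1 - D * q ^+ k.+1 /\
              u k.+1 + D * q ^+ k.+1 <= u k + D * q ^+ k.
  have := uC k; rewrite ler_norml -DC exprS; move/andP=> [h1 h2].
  by split; lra.
pose lo k := u k - D * q ^+ k; pose hi k := u k + D * q ^+ k.
have lo_homo : {homo lo : i j / (i <= j)%N >-> i <= j}.
  by apply: homo_leq => // [j i k|k]; [exact: le_trans|case: (step k)].
have hi_homo : {homo hi : i j / (i <= j)%N >-> j <= i}.
  by apply: (@homo_leq _ _ (fun a b => b <= a)) => // [j i k a b|k];
    [exact: le_trans b a|case: (step k)].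
have lo_le_hi k : lo k <= hi k.
  by rewrite lerD2l ge0_cp // mulr_ge0 // exprn_ge0.
have lo_hi i j : lo i <= hi j.
  have [ij|/ltnW ji] := leqP i j.
    exact: le_trans (lo_homo _ _ ij) (lo_le_hi j).
  exact: le_trans (lo_le_hi i) (hi_homo _ _ ji).
exists (sup (range lo)) => k.
have h1 : lo k <= sup (range lo).
  by apply: ub_le_sup; [exists (hi 0%N) => _ [i _ <-]|exists k].
have h2 : sup (range lo) <= hi k.
  by apply: ge_sup; [exists (lo 0%N), 0%N|move=> _ [i _ <-]].
by move: h1 h2; rewrite /lo /hi ler_norml => h1 h2; apply/andP; split; lra.
Qed.

Lemma geometric_limit_cV (R : realType) (m : nat) (u : nat -> 'cV[R]_m)
    (C q : R) :
    0 <= q < 1 -> (forall k, norm2 (u k.+1 - u k) <= C * q ^+ k) ->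
  exists D l, forall k, norm2 (u k - l) <= D * q ^+ k.
Proof.
move=> q01 uC.
have /choice[l ul] : forall i : 'I_m, exists l, forall k,
    `|u k i 0 - l| <= C / (1 - q) * q ^+ k.
  move=> i; apply: geometric_limit => // k; apply: le_trans (uC k).
  by have := ler_coord_norm2 (u k.+1 - u k) i; rewrite !mxE.
exists (m%:R * (C / (1 - q))), (\col_i l i) => k.
apply: le_trans (norm2_le_sum _) _.
have -> : m%:R * (C / (1 - q)) * q ^+ k = \sum_(i < m) (C / (1 - q) * q ^+ k).
  by rewrite sumr_const card_ord -mulrA mulr_natl.
by apply: ler_sum => i _; rewrite !mxE.
Qed.

Lemma geometric_cvg (R : realType) (m : nat) (u : nat -> 'cV[R]_m) z :
  converges_geometrically u z -> u k @[k --> \oo] --> z.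
Proof.
move=> [C [q [C0 /andP[q0 q1] uz]]].
have gq : (geometric C q : nat -> R) k @[k --> \oo] --> (0 : R).
  by apply: cvg_geometric; rewrite ger0_norm.
apply/cvgrPdist_le => eps eps0.
have /cvgrPdist_le/(_ eps eps0) := gq.
apply: filterS => k; rewrite sub0r normrN => h.
rewrite distrC; apply: le_trans (mx_norm_le_norm2 _) _.
apply: le_trans (uz k) _; apply: le_trans h; exact: ler_norm.
Qed.

Lemma geometric_bounded (R : realType) (m : nat) (u : nat -> 'cV[R]_m) z :
  converges_geometrically u z -> bounded_seq u.
Proof.
move=> [C [q [C0 /andP[q0 q1] uz]]]; exists (C + norm2 z) => k.
rewrite -[u k](subrK z); apply: le_trans (ler_norm2D _ _) _.
rewrite lerD2r; apply: le_trans (uz k) _.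
by rewrite ler_piMr // exprn_ile1 // ltW.
Qed.

(** * One step of the iteration *)

Section StepSizes.
Variables (R : realType) (n d : nat).
Variables (alpha gamma : 'I_n -> R) (A : 'I_n -> 'M[R]_d) (a g : R).
Hypotheses (alpha_gt0 : forall i, 0 < alpha i).
Hypotheses (alpha_le : forall i, alpha i <= a).
Hypotheses (g_ge0 : 0 <= g) (gamma_ge : forall i, g <= gamma i).
Hypothesis A_unit : forall i, A i \in unitmx.
Hypothesis A_pos : forall i (y : 'cV[R]_d), y != 0 ->
       gamma i * norm2 y ^+ 2 <= (y^T *m invmx (A i) *m y) 0 0.
Variable y : 'I_n -> 'cV[R]_d.

Definition gain (y : 'I_n -> 'cV[R]_d) i := alpha i *: (A i *m y i).

(** With u_i = A_i y_i, the i-th term of the right-hand side is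
    a alpha_i u_i . A_i^{-1} u_i, at least
    a alpha_i gamma_i |u_i|^2, while that of the left-hand side is
    g alpha_i^2 |u_i|^2. *)
Lemma gain_dissipation :
  g * norm2 (stack (gain y)) ^+ 2 <= a * dot (stack (gain y)) (stack y).
Proof.
rewrite norm2_stack_sq dot_stack !mulr_sumr; apply: ler_sum => i _.
rewrite /gain; set u := A i *m y i.
have yE : y i = invmx (A i) *m u by rewrite mulKmx.
have pos : gamma i * norm2 u ^+ 2 <= dot u (y i).
  have [u0|uN0] := eqVneq u 0; last by rewrite yE /dot mulmxA A_pos.
  by rewrite u0 norm2_sq /dot mulmx0 trmx0 mul0mx mxE mulr0.
rewrite norm2Z dotZl exprMn real_normK ?num_real //.
have a0 : 0 <= a by apply: le_trans (alpha_le i); exact: ltW.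
set p := norm2 u ^+ 2 in pos *.
have p0 : 0 <= p by exact: sqr_ge0.
have -> : g * (alpha i ^+ 2 * p) = alpha i * (alpha i * (g * p)) by ring.
rewrite [leRHS]mulrCA ler_pM2l //.
apply: ler_pM => //; [exact: ltW|exact: mulr_ge0|].
by apply: le_trans pos; rewrite ler_wpM2r.
Qed.

End StepSizes.

(** The block diagonal gain matrix has a bounded inverse, so a small
    displacement forces L X to be small. *)
Lemma gain_injective (R : realType) (n d : nat) (alpha : 'I_n -> R)
   (A : 'I_n -> 'M[R]_d) : (forall i, 0 < alpha i) ->
  (forall i, A i \in unitmx) ->
  exists2 c, 0 <= c &
    forall y, norm2 (stack y) <= c * norm2 (stack (gain alpha A y)).
Proof.
move=> alpha_gt0 A_unit.
have [c c0 H] := norm2_mulmx_le (\mxdiag_(i < n) ((alpha i)^-1 *: invmx (A i))).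
exists c => // y; apply: le_trans (H _); rewrite /stack mul_mxdiag_mxcol.
suff -> : \mxcol_i y i =
  \mxcol_i ((alpha i)^-1 *: invmx (A i) *m gain alpha A y i) by [].
apply: eq_mxcol => i; rewrite /gain -scalemxAl -scalemxAr scalerA.
by rewrite mulVf ?lt0r_neq0 // scale1r mulKmx.
Qed.

Lemma energyB_le (R : realType) (n d : nat) (e : rel 'I_n) (e_sym : symmetric e)
    (X W : 'cV[R]_(\sum_(i < n) d)) :
  energy e (X - W) <= energy e X - 2 * dot W (laplacian R d e *m X)
                      + spectral_norm (laplacian R d e) * norm2 W ^+ 2.
Proof.
have WW : energy e W <= spectral_norm (laplacian R d e) * norm2 W ^+ 2.
  apply: le_trans (cauchy_schwarz _ _) _.
  by rewrite mulrC expr2 mulrA ler_wpM2r ?norm2_ge0 // norm2_mulmx.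
rewrite /energy in WW *.
rewrite mulmxBr !(dotBl, dotBr) (dot_laplacianC e_sym X W).
lra.
Qed.

(** From a small energy drop follows a small displacement, then a small L X,
    then a small energy: the energy E is at most K times its drop E - E', that
    is E' <= (1 - 1/K) E. *)
Lemma energy_contraction (R : realType) (n d : nat) (e : rel 'I_n.+1)
    (alpha gamma : 'I_n.+1 -> R) (A : 'I_n.+1 -> 'M[R]_d) (a g : R) :
    symmetric e -> irreflexive e -> connected_graph e ->
    (forall i, 0 < alpha i) -> (forall i, alpha i <= a) ->
    0 <= g -> (forall i, g <= gamma i) ->
    (forall i, A i \in unitmx) ->
    (forall i (y : 'cV[R]_d), y != 0 ->
       gamma i * norm2 y ^+ 2 <= (y^T *m invmx (A i) *m y) 0 0) ->
    a * spectral_norm (laplacian R d e) < 2 * g ->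
  exists r D, [/\ 0 <= r < 1, 0 <= D &
    forall x y, laplacian R d e *m stack x = stack y ->
      energy e (stack x - stack (gain alpha A y)) <= r * energy e (stack x) /\
      norm2 (stack (gain alpha A y)) ^+ 2 <= D * energy e (stack x)].
Proof.
move=> e_sym e_irr e_conn alpha_gt0 alpha_le g_ge0 gamma_ge A_unit A_pos small.
set L := laplacian R d e in small *.
pose delta := 2 * g - a * spectral_norm L.
have delta_gt0 : 0 < delta by rewrite subr_gt0.
have a_gt0 : 0 < a by apply: lt_le_trans (alpha_le ord0).
have [c c0 cP] := gain_injective alpha_gt0 A_unit.
pose D := a / delta.
have D0 : 0 <= D by rewrite divr_ge0 // ltW.
(* The summand 1 makes K >= 1, hence 0 <= 1 - 1/K < 1. *)
pose K := 1 + n.+1%:R ^+ 3 * c ^+ 2 * D.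
have K_ge1 : 1 <= K by rewrite lerDl mulr_ge0 // mulr_ge0 ?exprn_ge0.
have K_gt0 : 0 < K by exact: lt_le_trans K_ge1.
exists (1 - K^-1), D; split=> //.
  by rewrite subr_ge0 invf_le1 // K_ge1 ltrBlDr ltrDl invr_gt0 K_gt0.
move=> x y xy; set W := stack (gain _ _ _).
set E := energy e (stack x); set E' := energy e (_ - _).
have E'_ge0 : 0 <= E' by exact: energy_ge0.
have W_drop : norm2 W ^+ 2 <= D * (E - E').
  rewrite /D mulrAC ler_pdivlMr // /delta.
  have := gain_dissipation alpha_gt0 alpha_le g_ge0 gamma_ge A_unit A_pos y.
  have := energyB_le e_sym (stack x) W; rewrite xy -/E -/E' -/L -/W.
  by rewrite -(ler_pM2l a_gt0); lra.
have drop_ge0 : 0 <= E - E'.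
  by have := le_trans (sqr_ge0 _) W_drop; rewrite pmulr_rge0 // divr_gt0.
have E_drop : E <= K * (E - E').
  apply: le_trans (energy_le_laplacian_sq e_sym e_irr e_conn x) _.
  rewrite xy /K mulrDl mul1r -[leLHS]add0r lerD //.
  rewrite -(mulrA (_ * _)) -(mulrA (_ ^+ 3)).
  rewrite ler_wpM2l ?exprn_ge0 //.
  apply: (@le_trans _ _ (c ^+ 2 * norm2 W ^+ 2)).
    by rewrite -exprMn ler_pXn2r ?nnegrE ?mulr_ge0 ?norm2_ge0 ?cP.
  by rewrite ler_wpM2l ?exprn_ge0.
split.
  by rewrite mulrBl mul1r lerBrDr addrC -lerBrDr ler_pdivrMl.
by apply: le_trans W_drop _; rewrite ler_wpM2l // gerBl.
Qed.

(** * Convergence to consensus *)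

Lemma le_family_max (R : realType) (n : nat) (f : 'I_n.+1 -> R) i :
  f i <= family_max f.
Proof. exact: le_bigmax. Qed.

Lemma family_min_le (R : realType) (n : nat) (f : 'I_n.+1 -> R) i :
  family_min f <= f i.
Proof. exact: bigmin_le_cond. Qed.

Lemma family_min_gt0 (R : realType) (n : nat) (f : 'I_n.+1 -> R) :
  (forall i, 0 < f i) -> 0 < family_min f.
Proof. by move=> f0; apply: lt_bigmin. Qed.

(** For c = 0 the quotient is +oo, and the conclusion is the positivity of b. *)
Lemma lt_div_ereal (R : realType) (a b c : R) : 0 < b -> 0 <= c ->
  (a%:E < b%:E / c%:E)%E -> a * c < b.
Proof.
move=> b0 c0; rewrite inver; case: eqP => [->|/eqP cN0]; first by rewrite mulr0.
by rewrite -EFinM lte_fin ltr_pdivlMr // lt_neqAle eq_sym cN0.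
Qed.

(* The graph has n.+1 >= 1 vertices.  The step-size quotient is taken in the
   extended reals, so that it is +oo in the one-vertex case, where L_V = 0. *)
Theorem theorem4 (R : realType) (n d : nat) (e : rel 'I_n.+1)
    (alpha gamma : 'I_n.+1 -> R) (A : 'I_n.+1 -> 'M[R]_d)
    (e_sym : symmetric e) (e_irr : irreflexive e)
    (e_conn : connected_graph e)
    (d_ge2 : (2 <= d)%N)
    (alpha_gt0 : forall i, 0 < alpha i)
    (A_unit : forall i, A i \in unitmx)
    (gamma_gt0 : forall i, 0 < gamma i)
    (A_pos : forall i (y : 'cV[R]_d), y != 0 ->
       gamma i * norm2 y ^+ 2 <= (y^T *m invmx (A i) *m y) 0 0)
    (alpha_max_gt0 : 0 < family_max alpha)
    (alpha_max_lt : ((family_max alpha)%:E <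
       (2 * family_min gamma)%:E / (spectral_norm (laplacian R d e))%:E)%E)
    (x : nat -> 'I_n.+1 -> 'cV[R]_d)
    (x_step : forall k i, x k.+1 i =
       x k i - alpha i *: \sum_(j in neighbors e i) A i *m (x k i - x k j)) :
  bounded_seq (fun k => stack (x k)) /\
  exists xs : 'cV[R]_d,
    converges_geometrically (fun k => stack (x k)) (consensus n.+1 xs) /\
    stack (x k) @[k --> \oo] --> consensus n.+1 xs.
Proof.
suff [xs conv] : exists xs : 'cV[R]_d,
    converges_geometrically (fun k => stack (x k)) (consensus n.+1 xs).
  split; first exact: geometric_bounded conv.
  by exists xs; split; [|exact: geometric_cvg conv].
have gmin0 := family_min_gt0 gamma_gt0.
have small : family_max alpha * spectral_norm (laplacian R d e) <
             2 * family_min gamma.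
  by apply: lt_div_ereal alpha_max_lt; rewrite ?mulr_gt0 // spectral_norm_ge0.
have [r [D [/andP[r0 r1] D0 contr]]] :=
  energy_contraction e_sym e_irr e_conn alpha_gt0 (le_family_max alpha)
    (ltW gmin0) (family_min_le gamma) A_unit A_pos small.
pose y k i := \sum_(j in neighbors e i) (x k i - x k j).
pose w k := gain alpha A (y k).
have xS k i : x k.+1 i = x k i - w k i.
  by rewrite x_step /w /gain -mulmx_sumr.
have Lx k : laplacian R d e *m stack (x k) = stack (y k).
  exact: laplacian_stack.
set E := fun k => energy e (stack (x k)).
have E_le k : E k <= r ^+ k * E 0%N.
  elim: k => [|k IH]; first by rewrite mul1r.
  rewrite exprS -mulrA; apply: le_trans (ler_wpM2l r0 IH).
  have [+ _] := contr _ _ (Lx k); congr (energy e _ <= _).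
  by rewrite stackB /stack; apply: eq_mxcol => i; rewrite xS.
have E0 : 0 <= E 0%N by exact: energy_ge0.
(* V is quadratic in the disagreements, hence the square root of its rate. *)
pose q := Num.sqrt r.
have q0 : 0 <= q by exact: sqrtr_ge0.
have q1 : q < 1 by rewrite -sqrtr1 ltr_sqrt.
have sqrtE k c : 0 <= c ->
    Num.sqrt (c * (r ^+ k * E 0%N)) = Num.sqrt (c * E 0%N) * q ^+ k.
  move=> c0; rewrite mulrCA mulrC sqrtrM ?mulr_ge0 //; congr (_ * _).
  by rewrite -{1}(sqr_sqrtr r0) exprAC sqrtr_sqr ger0_norm // exprn_ge0.
have [B [xs x0_le]] : exists B xs,
    forall k, norm2 (x k ord0 - xs) <= B * q ^+ k.
  apply: (@geometric_limit_cV _ _ _ (Num.sqrt (D * E 0%N))).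
    by rewrite q0.
  move=> k; rewrite xS addrC addKr norm2N.
  apply: le_trans (norm2_block_le _ _) _.
  rewrite -sqrtE // -(ger0_norm (norm2_ge0 _)) -sqrtr_sqr ler_wsqrtr //.
  have [_ +] := contr _ _ (Lx k); move/le_trans; apply.
  by rewrite ler_wpM2l // E_le.
have B0 : 0 <= B by have := le_trans (norm2_ge0 _) (x0_le 0%N); rewrite mulr1.
exists xs, (n.+1%:R * (n.+1%:R * Num.sqrt (E 0%N) + B)), q; split.
- by rewrite mulr_ge0 // addr_ge0 // mulr_ge0 // sqrtr_ge0.
- by rewrite q0.
move=> k; rewrite /consensus stackB; apply: le_trans (norm2_stack_le _) _.
have -> : n.+1%:R * (n.+1%:R * Num.sqrt (E 0%N) + B) * q ^+ k =
    \sum_(i < n.+1) ((n.+1%:R * Num.sqrt (E 0%N) + B) * q ^+ k).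
  by rewrite sumr_const card_ord -mulrA mulr_natl.
apply: ler_sum => i _; rewrite -(subrKA (x k ord0)) mulrDl.
apply: le_trans (ler_norm2D _ _) _; apply: lerD => //.
apply: le_trans (disagreement_le_energy e_sym e_irr e_conn _ _ _) _.
rewrite -mulrA ler_wpM2l //.
by have := @sqrtE k 1 ler01; rewrite !mul1r => <-; rewrite ler_wsqrtr // E_le.
Qed.
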